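(* The second integral group homology group $H_2(SL_2(\mathbb{Z}[t,t^{-1}]);\mathbb{Z})$ is not a finitely generated abelian group.
   Context: $\mathbb{Z}[t,t^{-1}]$ is the ring of Laurent polynomials in one variable $t$ over $\mathbb{Z}$, and $SL_2(\mathbb{Z}[t,t^{-1}])$ is the (discrete) group of $2\times 2$ matrices of determinant $1$ over it. $H_2(G;\mathbb{Z})$ denotes the homology of the group $G$ with coefficients in the trivial $G$-module $\mathbb{Z}$. *)

(* Defs.v *)
From HB Require Import structures.
From mathcomp Require Import freeg.
From mathcomp Require Import all_boot all_order all_algebra.
From mathcomp Require Import boolp.

Set Implicit Arguments.
Unset Strict Implicit.
Unset Printing Implicit Defensive.

Import GRing.Theory.
Import Quotient.

Local Open Scope ring_scope.

Section FreegLinear.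
Variables (R : nzRingType) (K : choiceType).

Lemma fglift_zmod_morphism (M : lmodType R) (f : K -> M) :
  zmod_morphism (fglift f).
Proof. exact: lift_is_additive. Qed.

HB.instance Definition _ (M : lmodType R) (f : K -> M) :=
  GRing.isZmodMorphism.Build {freeg K / R} M (fglift f)
    (fglift_zmod_morphism f).

Lemma freegU_scale (a : R) (k : K) : << a *g k >> = a *: << k >> :> {freeg K / R}.
Proof. by apply/eqP/freeg_eqP => x; rewrite coeffZ !coeffU mul1r. Qed.

Lemma fglift1 (M : lmodType R) (f : K -> M) k : fglift f << k >> = f k.
Proof. by rewrite liftU scale1r. Qed.

Lemma fgliftE (M : lmodType R) (f : K -> M) D :
  fglift f D = \sum_(k <- dom D) coeff k D *: f k.
Proof.
rewrite -{1}[D]freeg_sumE raddf_sum /=.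
by apply: eq_bigr => k _; rewrite liftU.
Qed.

Lemma fglift_is_scalable (M : lmodType R) (f : K -> M) : scalable (fglift f).
Proof.
move=> a D.
have -> : a *: D = \sum_(k <- dom D) << a * coeff k D *g k >>.
  rewrite -{1}[D]freeg_sumE scaler_sumr; apply: eq_bigr => k _.
  by rewrite freegU_scale scalerA -freegU_scale.
rewrite raddf_sum fgliftE; 
rewrite [RHS]scaler_sumr.
by apply: eq_bigr => k _ /=; rewrite liftU scalerA.
Qed.

HB.instance Definition _ (M : lmodType R) (f : K -> M) :=
  GRing.isScalable.Build R {freeg K / R} M *:%R (fglift f)
    (fglift_is_scalable f).

Lemma freeg_linear_eq (M : lmodType R) (f g : {linear {freeg K / R} -> M}) :
  (forall k, f << k >> = g << k >>) -> f =1 g.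
Proof.
move=> fg D; rewrite -[D]freeg_sumE !raddf_sum; apply: eq_bigr => k _.
by rewrite /= freegU_scale !linearZ /= fg.
Qed.

End FreegLinear.

(* A Laurent polynomial over R is a finitely supported function int -> R, with
   << a *g i >> standing for the monomial a t^i and the Cauchy product as
   multiplication. *)
Definition laurent (R : comNzRingType) : Type := {freeg int / R}.

Section Laurent.
Variable R : comNzRingType.

HB.instance Definition _ := GRing.Lmodule.on (laurent R).

Implicit Types p q r : laurent R.

Definition laurent_one : laurent R := << 0%:Z >>.

Definition laurent_mul p q : laurent R :=
  fglift (fun i : int => fglift (fun j : int => << i + j >> : {freeg int / R}) q) p.

Lemma laurent_mulU (i j : int) : laurent_mul << i >> << j >> = << i + j >>.
Proof. by rewrite /laurent_mul !fglift1. Qed.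

Lemma laurent_mulr_linear p : linear (laurent_mul p).
Proof.
move=> a q1 q2; rewrite /laurent_mul !(fgliftE _ p) scaler_sumr -big_split.
by apply: eq_bigr => i _ /=; rewrite linearP scalerDr !scalerA mulrC.
Qed.

Lemma laurent_mull_linear q : linear (laurent_mul^~ q).
Proof. by move=> a p1 p2; rewrite /laurent_mul linearP. Qed.

HB.instance Definition _ p :=
  GRing.isLinear.Build R (laurent R) (laurent R) *:%R (laurent_mul p)
    (laurent_mulr_linear p).

Definition laurent_mull q p := laurent_mul p q.

HB.instance Definition _ q :=
  GRing.isLinear.Build R (laurent R) (laurent R) *:%R (laurent_mull q)
    (laurent_mull_linear q).

Lemma laurent_mulC : commutative laurent_mul.
Proof.
move=> p q; rewrite -[LHS]/(laurent_mull q p).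
move: p; apply: freeg_linear_eq => i /=.
rewrite /laurent_mull -[RHS]/(laurent_mull << i >> q).
move: q; apply: freeg_linear_eq => j /=.
by rewrite /laurent_mull !laurent_mulU addrC.
Qed.

Lemma laurent_mulA : associative laurent_mul.
Proof.
move=> p q r.
rewrite -[LHS]/(laurent_mull (laurent_mul q r) p).
rewrite -[RHS]/((laurent_mull r \o laurent_mull q) p).
move: p; apply: freeg_linear_eq => i /=; rewrite /laurent_mull.
rewrite -[LHS]/((laurent_mul << i >> \o laurent_mull r) q).
rewrite -[RHS]/((laurent_mull r \o laurent_mul << i >>) q).
move: q; apply: freeg_linear_eq => j /=; rewrite /laurent_mull laurent_mulU.
rewrite -[LHS]/((laurent_mul << i >> \o laurent_mul << j >>) r).
move: r; apply: freeg_linear_eq => k /=.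
by rewrite !laurent_mulU addrA.
Qed.

Lemma laurent_mul1 : left_id laurent_one laurent_mul.
Proof.
move=> p; rewrite -[RHS]/(idfun p).
by move: p; apply: freeg_linear_eq => i /=; rewrite laurent_mulU add0r.
Qed.

Lemma laurent_mulDl : left_distributive laurent_mul +%R.
Proof. by move=> p q r; rewrite /laurent_mul raddfD. Qed.

Lemma laurent_one_neq0 : laurent_one != 0.
Proof. by rewrite freegU_eq0 oner_neq0. Qed.

HB.instance Definition _ :=
  GRing.Zmodule_isComNzRing.Build (laurent R)
    laurent_mulA laurent_mulC laurent_mul1 laurent_mulDl laurent_one_neq0.

End Laurent.

Record SL (n : nat) (R : comNzRingType) : predArgType := MkSL {
  SL_val :> 'M[R]_n;
  _ : \det SL_val == 1
}.

Notation "''SL_' n [ R ]" := (SL n R)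
  (at level 0, n at level 2, format "''SL_' n [ R ]") : type_scope.

Section SpecialLinear.
Variables (n : nat) (R : comNzRingType).

HB.instance Definition _ := [isSub for @SL_val n R].
HB.instance Definition _ := [Choice of 'SL_n[R] by <:].

Implicit Types A B : 'SL_n[R].

Lemma SL_det A : \det A = 1.
Proof. exact/eqP/(valP A). Qed.

Fact SL_one_subproof : \det (1%:M : 'M[R]_n) == 1.
Proof. by rewrite det1. Qed.

Fact SL_mul_subproof A B : \det (A *m B) == 1.
Proof. by rewrite det_mulmx !SL_det mulr1. Qed.

Fact SL_inv_subproof A : \det (\adj A) == 1.
Proof.
have := congr1 determinant (mul_mx_adj A).
by rewrite det_mulmx SL_det mul1r det1 => ->.
Qed.

Definition SL_one : 'SL_n[R] := MkSL SL_one_subproof.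
Definition SL_mul A B : 'SL_n[R] := MkSL (SL_mul_subproof A B).
(* As \det A = 1, the inverse of A is its adjugate. *)
Definition SL_inv A : 'SL_n[R] := MkSL (SL_inv_subproof A).

Lemma SL_mulA : associative SL_mul.
Proof. by move=> A B C; apply/val_inj/mulmxA. Qed.

Lemma SL_mul1 : left_id SL_one SL_mul.
Proof. by move=> A; apply/val_inj/mul1mx. Qed.

Lemma SL_mulr1 : right_id SL_one SL_mul.
Proof. by move=> A; apply/val_inj/mulmx1. Qed.

Lemma SL_mulV : left_inverse SL_one SL_inv SL_mul.
Proof. by move=> A; apply/val_inj; rewrite /= mul_adj_mx SL_det. Qed.

Lemma SL_mulrV : right_inverse SL_one SL_inv SL_mul.
Proof. by move=> A; apply/val_inj; rewrite /= mul_mx_adj SL_det. Qed.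

HB.instance Definition _ :=
  isGroup.Build 'SL_n[R] SL_mulA SL_mul1 SL_mulr1 SL_mulV SL_mulrV.

End SpecialLinear.

(* Homology with trivial coefficients int, computed by the inhomogeneous bar
   complex int [G^n]:
     d [g_1 | ... | g_(n+1)] = [g_2 | ... | g_(n+1)]
       + \sum_(1 <= i <= n) (-1)^i [g_1 | ... | g_i g_(i+1) | ... | g_(n+1)]
       + (-1)^(n+1) [g_1 | ... | g_n]. *)
Section GroupHomology.
Variable G : groupType.

Definition bar_chain (n : nat) : Type := {freeg (n.-tuple G) / int}.

HB.instance Definition _ n := GRing.Lmodule.on (bar_chain n).

(* Slots of tuples are numbered from 0, so the inner face i multiplies the
   entries in slots i - 1 and i. *)
Definition bar_face n (i : 'I_n.+2) (g : n.+1.-tuple G) : n.-tuple G :=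
  [tuple let l := tnth g (lift ord_max j) in
         let r := tnth g (lift ord0 j) in
         if (j.+1 < i)%N then l else if j.+1 == i then (l * r)%g else r
  | j < n].

Definition bar_d n : bar_chain n.+1 -> bar_chain n :=
  fglift (fun g => \sum_(i < n.+2) (-1) ^+ i *: << bar_face i g >>).

HB.instance Definition _ n := GRing.Linear.on (@bar_d n).

Definition is_bar_cycle n : {pred bar_chain n} :=
  match n return {pred bar_chain n} with
  | 0 => predT
  | m.+1 => fun c => bar_d c == 0
  end.

Lemma is_bar_cycle_zmod_closed n : zmod_closed (@is_bar_cycle n).
Proof.
case: n => [|n]; first by [].
split=> [|x y]; rewrite !unfold_in /= ?raddf0 ?eqxx //.
by move=> /eqP xc /eqP yc; rewrite raddfB /= xc yc subrr.
Qed.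

HB.instance Definition _ n :=
  GRing.isZmodClosed.Build (bar_chain n) (@is_bar_cycle n) (@is_bar_cycle_zmod_closed n).

Record bar_cycle (n : nat) : predArgType := MkBarCycle {
  bar_cycle_val :> bar_chain n;
  _ : bar_cycle_val \in @is_bar_cycle n
}.

HB.instance Definition _ n := [isSub for @bar_cycle_val n].
HB.instance Definition _ n := [Choice of bar_cycle n by <:].
HB.instance Definition _ n := [SubChoice_isSubZmodule of bar_cycle n by <:].

Definition is_bar_boundary n : {pred bar_cycle n} :=
  fun z => `[< exists c : bar_chain n.+1, bar_cycle_val z = bar_d c >].

Lemma is_bar_boundary_zmod_closed n : zmod_closed (@is_bar_boundary n).
Proof.
split=> [|x y]; first by apply/asboolP; exists 0; rewrite raddf0.
move=> /asboolP[a xa] /asboolP[b yb]; apply/asboolP; exists (a - b).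
by rewrite raddfB /= -xa -yb.
Qed.

HB.instance Definition _ n :=
  GRing.isZmodClosed.Build (bar_cycle n) (@is_bar_boundary n)
    (@is_bar_boundary_zmod_closed n).

Definition homology (n : nat) : zmodType := {quot @is_bar_boundary n}.

End GroupHomology.

Definition finitely_generated (V : zmodType) : Prop :=
  exists (m : nat) (s : m.-tuple V), forall v : V, inIntSpan s v.

(* Main.v *)
(* Reduce mod 2 and attach to every row r over F_2[t,t^-1], thought of as a cusp,
   the affine line on which SL_2 acts by Moebius transformations in a coordinate
   sending that cusp to infinity; differences of coordinates depend on r only.
   Fix two base points. Given g and h, the difference of the coordinates of the
   translates of the first one, expanded at t = 0, has a coefficient of t^0; that
   of the translates of the second one, expanded at t = infinity, has a
   coefficient of t^d. Both are 1-cocycles with values in F_2, and their cup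
   product, summed over all r, is an invariant 2-cocycle C_d. The sum is finite
   because the first base point is chosen as a vertex of the tree at t = 0 (the
   column of g whose product with r has the least order at 0): a nonzero term
   bounds the order of r at 0 from below, and then the expansion at infinity
   bounds its degree from above. On the cycle [u(1)|u(t^e)] - [u(t^e)|u(1)] of
   commuting unipotents with e <= d only the row (0, 1) can contribute, and C_d
   takes the value 1 if e = d and 0 if e < d. These values form unitriangular
   matrices of arbitrary size, which finitely many generators do not permit. *)
From HB Require Import structures.
Require Import Defs.
From mathcomp Require Import all_boot all_order all_algebra.
From mathcomp Require Import freeg finmap zify ring boolp.
From mathcomp Require Import classical_sets functions cardinality fsbigop.

Set Implicit Arguments.
Unset Strict Implicit.
Unset Printing Implicit Defensive.

Import Order.TTheory GRing.Theory Num.Theory.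

Local Open Scope classical_set_scope.
Local Open Scope ring_scope.

(** * The place at infinity of F(X) *)

Section DegreeAtInfinity.
Variable F : fieldType.
Local Open Scope quotient_scope.
Local Notation K := {fraction {poly F}}.
Local Notation "p %:F" := (@FracField.tofrac _ p).
Implicit Types (z w : K) (p q : {poly F}) (n m : int).

Lemma fraction_numden z : z = (\n_(repr z))%:F / (\d_(repr z))%:F.
Proof.
have d0 : (\d_(repr z))%:F != 0 :> K by rewrite tofrac_eq0 denom_ratioP.
apply: (mulIf d0); rewrite divfK //.
elim/quotW: z {d0} => x.
set y := repr _.
have -> : \pi_(FracField.type {poly F}) x = \pi y by rewrite /y reprK.
move: y => {}x.
rewrite -[LHS]/(FracField.mul _ _) !piE.
apply/eqP; rewrite piE FracField.equivfE /FracField.mulf.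
rewrite !numden_Ratio ?mulr1 ?denom_ratioP ?oner_eq0 //.
by rewrite mulrC.
Qed.

Lemma fraction_eq p q p' q' : q != 0 -> q' != 0 ->
  p%:F / q%:F = p'%:F / q'%:F :> K -> p * q' = p' * q.
Proof.
move=> q0 q'0 /eqP; rewrite eqr_div ?tofrac_eq0 // -!tofracM tofrac_eq.
by move/eqP.
Qed.

(** Each size exceeds its degree by one and the two offsets cancel; the value at 0 is junk. *)
Definition fdeg z : int :=
  (size \n_(repr z))%:Z - (size \d_(repr z))%:Z.

Lemma fdegE p q : p != 0 -> q != 0 ->
  fdeg (p%:F / q%:F) = (size p)%:Z - (size q)%:Z.
Proof.
move=> p0 q0; rewrite /fdeg; set z := p%:F / q%:F.
have d0 := denom_ratioP (repr z); move: (fraction_numden z); rewrite {1}/z.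
move/(fraction_eq q0 d0) => e.
have n0 : \n_(repr z) != 0.
  by apply: contraNneq (mulf_neq0 p0 d0) => h; rewrite e h mul0r.
move/(congr1 (fun r : {poly F} => size r)): e; rewrite !size_mul //.
move: d0 n0 p0 q0; rewrite -!size_poly_gt0.
move: (size p) (size q) (size \n_(repr z)) (size \d_(repr z)) => a b c d; lia.
Qed.

Lemma fraction_ind z : z != 0 ->
  exists p q, [/\ p != 0, q != 0 & z = p%:F / q%:F].
Proof.
move=> z0; exists \n_(repr z), \d_(repr z); rewrite denom_ratioP; split=> //.
  by apply: contraNneq z0 => h; rewrite [z]fraction_numden h tofrac0 mul0r.
exact: fraction_numden.
Qed.

Lemma fdegM z w : z != 0 -> w != 0 -> fdeg (z * w) = fdeg z + fdeg w.
Proof.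
move=> /fraction_ind[p [q [p0 q0 ->]]] /fraction_ind[p' [q' [p'0 q'0 ->]]].
rewrite mulf_div -!tofracM !fdegE ?mulf_neq0 // !size_mul //.
move: p0 q0 p'0 q'0; rewrite -!size_poly_gt0.
move: (size p) (size q) (size p') (size q') => a b c d; lia.
Qed.

Lemma fdegD z w : z != 0 -> w != 0 -> z + w != 0 ->
  fdeg (z + w) <= Num.max (fdeg z) (fdeg w).
Proof.
move=> /fraction_ind[p [q [p0 q0 ->]]] /fraction_ind[p' [q' [p'0 q'0 ->]]].
rewrite addf_div ?tofrac_eq0 // -!tofracM -tofracD => h.
have s0 : p * q' + p' * q != 0.
  by apply: contraNneq h => ->; rewrite tofrac0 mul0r.
rewrite !fdegE ?mulf_neq0 //.
have := size_polyD (p * q') (p' * q); rewrite !size_mul //.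
move: p0 q0 p'0 q'0; rewrite -!size_poly_gt0.
move: (size p) (size q) (size p') (size q') (size (p * q' + p' * q)) => a b c d e. lia.
Qed.

(* The coefficient of X^0 in the Laurent expansion of z at infinity. *)
Definition const_coef z : F := (\n_(repr z) %/ \d_(repr z))`_0.

Lemma const_coefE p q : q != 0 -> const_coef (p%:F / q%:F) = (p %/ q)`_0.
Proof.
move=> q0; rewrite /const_coef; set z := p%:F / q%:F.
have d0 := denom_ratioP (repr z); move: (fraction_numden z); rewrite {1}/z.
move/(fraction_eq q0 d0) => e.
by rewrite -(@divp_pmul2r _ q) // -e [_ * q in X in _ %/ X]mulrC divp_pmul2r.
Qed.

(** Over a common denominator the Euclidean quotient is additive in the numerator. *)
Lemma const_coef_zmod_morphism : zmod_morphism const_coef.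
Proof.
move=> z w; rewrite [z]fraction_numden [w]fraction_numden.
move: (denom_ratioP (repr z)) (denom_ratioP (repr w)).
move: \n_(repr z) \d_(repr z) \n_(repr w) \d_(repr w) => p q p' q' q0 q'0.
rewrite !const_coefE // -mulNr -tofracN addf_div ?tofrac_eq0 //.
rewrite -!tofracM -tofracD const_coefE ?mulf_neq0 //.
by rewrite divpD coefD [X in (- p' * _) %/ X]mulrC !divp_pmul2r // divpN coefN.
Qed.

Lemma const_coef_eq0 z : z != 0 -> fdeg z < 0 -> const_coef z = 0.
Proof.
move=> /fraction_ind[p [q [p0 q0 ->]]]; rewrite fdegE // const_coefE //.
by move=> h; rewrite divp_small ?coef0 //; move: h; case: (size p) (size q); lia.
Qed.

Lemma frac_var_neq0 : 'X%:F != 0 :> K.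
Proof. by rewrite tofrac_eq0 polyX_eq0. Qed.

Lemma fdegX : fdeg 'X%:F = 1.
Proof.
rewrite -['X%:F]divr1 -tofrac1 fdegE ?polyX_eq0 ?oner_eq0 //.
by rewrite size_polyX size_poly1.
Qed.

Lemma const_coefX k : const_coef ('X%:F ^+ k) = (k == 0%N)%:R.
Proof.
rewrite -tofracXn -['X^k%:F]divr1 -tofrac1 const_coefE ?oner_eq0 //.
by rewrite divp1 coefXn eq_sym.
Qed.

End DegreeAtInfinity.

(* Axiomatic place at infinity: pdeg is minus a discrete valuation, and coef0p
   reads off the coefficient of var^0. Keeping the field abstract prevents
   unification from unfolding {fraction {poly F}}. *)
Record place (F : fieldType) := Place {
  place_field :> fieldType;
  pdeg : place_field -> int;
  coef0p : place_field -> F;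
  var : place_field;
  pdegM : forall z w, z != 0 -> w != 0 -> pdeg (z * w) = pdeg z + pdeg w;
  pdegD : forall z w, z != 0 -> w != 0 -> z + w != 0 ->
    pdeg (z + w) <= Num.max (pdeg z) (pdeg w);
  place_pchar : [pchar place_field] =i [pchar F];
  var_neq0 : var != 0;
  pdeg_var : pdeg var = 1;
  coef0p_zmod_morphism : zmod_morphism coef0p;
  coef0p_eq0 : forall z, z != 0 -> pdeg z < 0 -> coef0p z = 0;
  coef0p_varXn : forall k, coef0p (var ^+ k) = (k == 0%N)%:R
}.

Lemma place_at_infinity (F : fieldType) : place F.
Proof.
exact: (Place (@fdegM F) (@fdegD F)
  (fmorph_pchar (@FracField.tofrac {poly F} \o polyC)) (frac_var_neq0 F) (fdegX F)
  (@const_coef_zmod_morphism F) (@const_coef_eq0 F) (@const_coefX F)).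
Qed.

(** * Degree bounds at a place *)

Section PlaceTheory.
Variables (F : fieldType) (P : place F).
Implicit Types (z w : P) (n m : int).

HB.instance Definition _ :=
  GRing.isZmodMorphism.Build P F (@coef0p F P) (@coef0p_zmod_morphism F P).

Lemma coef0p0 : coef0p (0 : P) = 0.
Proof. exact: raddf0. Qed.

Lemma pdeg1 : pdeg (1 : P) = 0.
Proof.
by have o0 : 1 != 0 :> P := oner_neq0 P; have := pdegM o0 o0; rewrite mulr1; lia.
Qed.

Lemma pdegV z : z != 0 -> pdeg z^-1 = - pdeg z.
Proof.
move=> z0; have := pdegM z0; move/(_ z^-1); rewrite invr_eq0 z0 divff // pdeg1.
by move/(_ isT); lia.
Qed.

Lemma pdegN z : pdeg (- z) = pdeg z.
Proof.
have [->|z0] := eqVneq z 0; first by rewrite oppr0.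
have n10 : - 1 != 0 :> P by rewrite oppr_eq0 oner_eq0.
have := pdegM n10 n10; rewrite mulrNN mulr1 pdeg1 => h.
have h0 : pdeg (- 1 : P) = 0 by lia.
by rewrite -mulN1r pdegM // h0 add0r.
Qed.

Lemma pdeg_varX n : pdeg (var P ^ n) = n.
Proof.
have h (k : nat) : pdeg (var P ^+ k) = k.
  elim: k => [|k IH]; first by rewrite expr0 pdeg1.
  by rewrite exprS pdegM ?expf_neq0 ?var_neq0 // IH pdeg_var; lia.
case: n => k; first exact: h.
by rewrite NegzE -exprnN pdegV ?expf_neq0 ?var_neq0 // h.
Qed.

(* pdeg 0 is a junk value, hence the disjunction. *)
Definition pdeg_le n z := (z == 0) || (pdeg z <= n).

Lemma pdeg_le0 n : pdeg_le n 0.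
Proof. by rewrite /pdeg_le eqxx. Qed.

Lemma pdeg_leE n z : z != 0 -> pdeg_le n z = (pdeg z <= n).
Proof. by move=> z0; rewrite /pdeg_le (negPf z0). Qed.

Lemma pdeg_le_trans n m z : n <= m -> pdeg_le n z -> pdeg_le m z.
Proof.
by move=> nm; rewrite /pdeg_le => /orP[->//|zn]; rewrite (le_trans zn nm) orbT.
Qed.

Lemma pdeg_leN n z : pdeg_le n (- z) = pdeg_le n z.
Proof. by rewrite /pdeg_le oppr_eq0 pdegN. Qed.

Lemma pdeg_leM n m z w : pdeg_le n z -> pdeg_le m w -> pdeg_le (n + m) (z * w).
Proof.
have [->|z0] := eqVneq z 0; first by rewrite mul0r => _ _; exact: pdeg_le0.
have [->|w0] := eqVneq w 0; first by rewrite mulr0 => _ _; exact: pdeg_le0.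
by rewrite !pdeg_leE ?mulf_neq0 // pdegM //; lia.
Qed.

Lemma pdeg_leD n z w : pdeg_le n z -> pdeg_le n w -> pdeg_le n (z + w).
Proof.
have [->|z0] := eqVneq z 0; first by rewrite add0r.
have [->|w0] := eqVneq w 0; first by rewrite addr0.
have [->|zw0] := eqVneq (z + w) 0; first by move=> _ _; exact: pdeg_le0.
rewrite !pdeg_leE // => zn wn; apply: le_trans (pdegD z0 w0 zw0) _.
by rewrite ge_max zn wn.
Qed.

Lemma pdeg_leB n z w : pdeg_le n z -> pdeg_le n w -> pdeg_le n (z - w).
Proof. by move=> zn wn; rewrite pdeg_leD ?pdeg_leN. Qed.

Lemma coef0p_neq0 z : coef0p z != 0 -> z != 0 /\ 0 <= pdeg z.
Proof.
move=> h; have [z0|z0] := eqVneq z 0; first by rewrite z0 raddf0 eqxx in h.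
split=> //; apply: contraNT h => zn; apply/eqP/coef0p_eq0 => //; lia.
Qed.

Lemma coef0p_varX n : coef0p (var P ^ n) = (n == 0)%:R.
Proof.
case: n => k; first by rewrite -exprnP coef0p_varXn.
by rewrite coef0p_eq0 ?expfz_neq0 ?var_neq0 // pdeg_varX.
Qed.

End PlaceTheory.

(** * Evaluation of integral Laurent polynomials *)

Section FreeAbelianLift.
Variables (T : choiceType) (V : zmodType).

(** A variant of [fglift] whose target is a bare [zmodType], so that fields and ['F_2] can serve as
    targets directly. *)
Definition zlift (f : T -> V) (D : {freeg T / int}) : V :=
  \sum_(k <- dom D) f k *~ coeff k D.

Lemma zlift_zmod_morphism f : zmod_morphism (zlift f).
Proof.
have h D : zlift f D = fglift (f : T -> zmodule V) D by rewrite fgliftE.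
by move=> D E; rewrite !h raddfB.
Qed.

HB.instance Definition _ f :=
  GRing.isZmodMorphism.Build {freeg T / int} V (zlift f) (zlift_zmod_morphism f).

Lemma zliftU f k : zlift f << k >> = f k.
Proof. by rewrite /zlift domU1 big_seq1 coeffU eqxx mulr1. Qed.

Lemma freeg_zind (Q : {freeg T / int} -> Prop) :
  Q 0 -> (forall k, Q << k >>) -> (forall D E, Q D -> Q E -> Q (D - E)) ->
  forall D, Q D.
Proof.
move=> Q0 QU QB D; have QN E : Q E -> Q (- E) by rewrite -sub0r; exact: QB.
have QD E E' : Q E -> Q E' -> Q (E + E').
  by move=> QE /QN; rewrite -{2}[E']opprK; exact: QB.
rewrite -[D]freeg_sumE; elim/big_ind: _ => // k _.
rewrite -[coeff k D]intz -freegU_mulz.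
have Qn (n : nat) : Q (<< k >> *+ n).
  by elim: n => [|n IH]; rewrite ?mulr0n // mulrS; exact: QD.
by case: (coeff k D) => n; [exact: Qn | apply: QN; exact: Qn].
Qed.

End FreeAbelianLift.

Section Evaluation.
Variables (K : fieldType) (x : K).
Hypothesis x0 : x != 0.
Implicit Types p q : laurent int.

Definition laurent_eval p : K := zlift (fun i : int => x ^ i) p.

HB.instance Definition _ := GRing.isZmodMorphism.Build (laurent int) K laurent_eval
  (zlift_zmod_morphism (fun i : int => x ^ i)).

Lemma laurent_evalU (i : int) : laurent_eval << i >> = x ^ i.
Proof. exact: zliftU. Qed.

Lemma laurent_evalM p q : laurent_eval (p * q) = laurent_eval p * laurent_eval q.
Proof.
elim/freeg_zind: p => [|i|p p' IH IH']; first by rewrite mul0r raddf0 mul0r.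
  elim/freeg_zind: q => [|j|q q' IH IH']; first by rewrite mulr0 raddf0 mulr0.
    by rewrite [_ * _]laurent_mulU !laurent_evalU expfzDr.
  by rewrite [in LHS]mulrBr !raddfB /= IH IH' mulrBr.
by rewrite [in LHS]mulrBl !raddfB /= IH IH' mulrBl.
Qed.

Lemma laurent_eval1 : laurent_eval 1 = 1.
Proof. by rewrite -[RHS](expr0z x) -laurent_evalU. Qed.

End Evaluation.

Lemma mulrz_pchar2 (R : nzRingType) (x : R) (c : int) :
  2%N \in [pchar R] -> x *~ c = x *+ odd `|c|%N.
Proof.
move=> R2; have h n : x *+ n = x *+ odd n.
  rewrite -{1}[n]odd_double_half mulrnDr -muln2 mulrnA -(mulr_natr _ 2).
  by rewrite pcharf0 // mulr0 addr0.
case: c => n; first exact: h.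
by rewrite NegzE mulrNz oppr_pchar2 // abszN; exact: h.
Qed.

(** * Reduction mod 2, expanded at t = 0 and at t = infinity *)

Section PlaceEvaluation.
Variable P : place 'F_2.
Implicit Types (s : bool) (p q : laurent int) (i n : int).

Let P2 : 2%N \in [pchar P].
Proof. by rewrite place_pchar pchar_Fp. Qed.

Definition sgb s : int := (-1) ^+ s.

(* t goes to var for s = false and to var^-1 for s = true, so that one and the
   same degree measures the top, resp. the bottom, exponent of p. *)
Definition place_eval s p : P := laurent_eval (var P ^ sgb s) p.

Let vs0 s : var P ^ sgb s != 0.
Proof. by rewrite expfz_neq0 ?var_neq0. Qed.

HB.instance Definition _ s := GRing.isZmodMorphism.Build (laurent int) P
  (place_eval s) (zlift_zmod_morphism (fun i : int => (var P ^ sgb s) ^ i)).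

Lemma place_eval_monoid_morphism s : monoid_morphism (place_eval s).
Proof. by split; [exact: laurent_eval1 | exact: (laurent_evalM (vs0 s))]. Qed.

HB.instance Definition _ s := GRing.isMonoidMorphism.Build (laurent int) P
  (place_eval s) (place_eval_monoid_morphism s).

Lemma place_evalU s i : place_eval s << i >> = var P ^ (sgb s * i).
Proof. by rewrite /place_eval laurent_evalU exprz_exp. Qed.

Definition oddc i p := odd `|coeff i p|%N.

(** The monomial factor shifts the t^i term to var^0, so either evaluation determines p mod 2. *)
Lemma place_eval_coef s i p :
  coef0p (var P ^ (- (sgb s * i)) * place_eval s p) = (oddc i p)%:R.
Proof.
rewrite -mulrz_pchar2 ?pchar_Fp //.
elim/freeg_zind: p => [|j|p q IHp IHq].
- by rewrite raddf0 mulr0 raddf0 coeff0.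
- rewrite place_evalU -expfzDr ?var_neq0 // coef0p_varX coeffU mul1r.
  rewrite addrC -mulrBr mulf_eq0 signr_eq0 subr_eq0 /=.
  by case: eqP.
- by rewrite raddfB mulrBr raddfB /= IHp IHq coeffB mulrzBr.
Qed.

Lemma place_eval_sum s p :
  place_eval s p = \sum_(i <- dom p | oddc i p) var P ^ (sgb s * i).
Proof.
rewrite big_mkcond; apply: eq_bigr => i _.
by rewrite mulrz_pchar2 // -/(oddc i p) exprz_exp; case: (oddc i p).
Qed.

Lemma oddc_pdeg s i p : oddc i p ->
  place_eval s p != 0 /\ sgb s * i <= pdeg (place_eval s p).
Proof.
move=> oi; have : coef0p (var P ^ (- (sgb s * i)) * place_eval s p) != 0.
  by rewrite place_eval_coef oi oner_eq0.
move=> /coef0p_neq0[]; rewrite mulf_eq0 negb_or => /andP[v0 e0].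
by rewrite pdegM // pdeg_varX; split=> //; lia.
Qed.

Lemma place_eval_neq0 s p : place_eval s p != 0 -> exists i, oddc i p.
Proof.
rewrite place_eval_sum => h; apply: contrapT => no; move/eqP: h; apply.
by rewrite big1 // => i oi; case: no; exists i.
Qed.

Lemma place_eval_neq0C s s' p : place_eval s p != 0 -> place_eval s' p != 0.
Proof. by move=> /place_eval_neq0[i /(oddc_pdeg s')[]]. Qed.

(** The two degrees are the top exponent of p mod 2 and minus the bottom one, in an order given by
    s; any exponent with odd coefficient lies between. *)
Lemma pdeg_place_eval_ge s p : place_eval s p != 0 ->
  0 <= pdeg (place_eval s p) + pdeg (place_eval (~~ s) p).
Proof.
move=> /place_eval_neq0[i oi].
have [_ h1] := oddc_pdeg s oi; have [_ h2] := oddc_pdeg (~~ s) oi.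
by apply: le_trans (lerD h1 h2); case: s {h1 h2}; rewrite /sgb /=; lia.
Qed.

Lemma place_eval_bounded (N : nat) p :
  (forall s, pdeg_le N%:Z (place_eval s p)) ->
  forall s, place_eval s p =
    \sum_(j < N.*2.+1 | oddc (j%:Z - N%:Z) p) var P ^ (sgb s * (j%:Z - N%:Z)).
Proof.
move=> bd s; have bi i : oddc i p -> (- N%:Z <= i <= N%:Z).
  move=> oi; have [n1 h1] := oddc_pdeg true oi; have [n2 h2] := oddc_pdeg false oi.
  move: (bd true) (bd false); rewrite !pdeg_leE // => b1 b2.
  by move: (le_trans h1 b1) (le_trans h2 b2); rewrite /sgb /=; lia.
rewrite place_eval_sum -[LHS]big_filter.
rewrite -(big_mkord (fun j => oddc (j%:Z - N%:Z) p)
  (fun j => var P ^ (sgb s * (j%:Z - N%:Z)))).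
rewrite -(big_map (fun j : nat => j%:Z - N%:Z) (fun i => oddc i p)
  (fun i => var P ^ (sgb s * i))).
rewrite -[RHS]big_filter; apply: perm_big; apply: uniq_perm.
- by rewrite filter_uniq // uniq_dom.
- by rewrite filter_uniq // map_inj_uniq ?iota_uniq // => a b; lia.
move=> i; rewrite !mem_filter; case: (boolP (oddc i p)) => [oi|//].
rewrite !andTb mem_dom; have -> : coeff i p != 0.
  by apply: contraTneq oi => ci; rewrite /oddc ci.
apply/esym/mapP; exists (absz (i + N%:Z)); last by have := bi _ oi; lia.
by rewrite mem_index_iota; have := bi _ oi; lia.
Qed.

(** The bounds confine the exponents to [-N, N], which leaves finitely many Laurent polynomials over
    F_2. *)
Lemma finite_place_eval_bounded (N : nat) :
  finite_set [set z : P * P | exists2 p, z = (place_eval false p, place_eval true p) &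
    forall s, pdeg_le N%:Z (place_eval s p)].
Proof.
pose g (b : {ffun 'I_N.*2.+1 -> bool}) : P * P :=
  (\sum_(j < N.*2.+1 | b j) var P ^ (sgb false * (j%:Z - N%:Z)),
   \sum_(j < N.*2.+1 | b j) var P ^ (sgb true * (j%:Z - N%:Z))).
apply: (@sub_finite_set _ _ (g @` setT)).
  move=> _ [p -> bd]; exists [ffun j : 'I_N.*2.+1 => oddc (j%:Z - N%:Z) p] => //.
  rewrite /g !(place_eval_bounded bd).
  by congr (_, _); apply: eq_bigl => j; rewrite ffunE.
exact/finite_image/finite_finset.
Qed.

(** Top exponent at most 0 and bottom exponent at least 0 leave only a constant of F_2. *)
Lemma place_eval_unit p : place_eval false p != 0 ->
  pdeg_le 0 (place_eval false p) -> pdeg_le 0 (place_eval true p) ->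
  forall s, place_eval s p = 1.
Proof.
move=> n0 h1 h2 s.
have bd r : pdeg_le 0%N%:Z (place_eval r p) by case: r.
have e r : place_eval r p = if oddc 0 p then 1 else 0.
  by rewrite (place_eval_bounded bd) big_mkcond big_ord1 /= subrr mulr0 expr0z.
by move: n0; rewrite !e; case: ifP; rewrite ?eqxx.
Qed.

End PlaceEvaluation.

(** * Coordinates at a cusp *)

Section TwoByTwo.
Variable R : comNzRingType.
Implicit Types (r : 'rV[R]_2) (g h : 'M[R]_2).

Lemma ord2P (j : 'I_2) : (j = 0) \/ (j = 1).
Proof. by case: j => [[|[|//]] lt_j2]; [left|right]; exact: val_inj. Qed.

Lemma sum_ord2 (f : 'I_2 -> R) : \sum_j f j = f 0 + f 1.
Proof. by rewrite big_ord_recl big_ord1; congr (_ + f _); exact: val_inj. Qed.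

Lemma mulmx2E m n (A : 'M[R]_(m, 2)) (B : 'M[R]_(2, n)) i j :
  (A *m B) i j = A i 0 * B 0 j + A i 1 * B 1 j.
Proof. by rewrite mxE sum_ord2. Qed.

Lemma det2E g : \det g = g 0 0 * g 1 1 - g 0 1 * g 1 0.
Proof.
rewrite (expand_det_row _ 0) sum_ord2 /cofactor !det_mx11 !mxE /=.
rewrite !expr0 expr1 mul1r mulN1r mulrN.
by congr (_ * g _ _ - _ * g _ _); exact: val_inj.
Qed.

Definition col_det g h j k : R := g 0 j * h 1 k - g 1 j * h 0 k.

Lemma col_detM (a : 'M[R]_2) g h j k :
  col_det (a *m g) (a *m h) j k = \det a * col_det g h j k.
Proof. rewrite /col_det !mulmx2E det2E; ring. Qed.

(* Cramer's rule. *)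
Lemma mul_col_det0 r g h j k :
  r 0 0 * col_det g h j k = (r *m g) 0 j * h 1 k - (r *m h) 0 k * g 1 j.
Proof. rewrite /col_det !mulmx2E; ring. Qed.

Lemma mul_col_det1 r g h j k :
  r 0 1 * col_det g h j k = (r *m h) 0 k * g 0 j - (r *m g) 0 j * h 0 k.
Proof. rewrite /col_det !mulmx2E; ring. Qed.

End TwoByTwo.

Section CuspDifference.
Variables (K : fieldType) (sel : 'rV[K]_2 -> 'I_2).
Implicit Types (r : 'rV[K]_2) (g h : 'M[K]_2).
Hypothesis selP : forall r, r != 0 -> r 0 (sel r) != 0.

Definition pivot r g : K := (r *m g) 0 (sel (r *m g)).

(* If r is the bottom row of k in SL_2, then the Moebius action of k moves the
   column of g chosen by sel to a point of the affine line that depends on k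
   only up to translation; this is the difference of the points got from g, h. *)
Definition cusp_diff r g h : K :=
  col_det g h (sel (r *m g)) (sel (r *m h)) / (pivot r g * pivot r h).

Lemma pivot_neq0 r g : r != 0 -> \det g = 1 -> pivot r g != 0.
Proof.
move=> r0 g1; apply: selP; apply: contraNneq r0 => rg.
have gu : g \in unitmx by rewrite unitmxE g1 unitr1.
by rewrite -(mulmxK gu r) rg mul0mx.
Qed.

Lemma cusp_diff0 g h : cusp_diff 0 g h = 0.
Proof. by rewrite /cusp_diff /pivot !mul0mx mxE mul0r invr0 mulr0. Qed.

(** With the pivots cleared, this is r applied to the linear relation among three vectors of a
    plane, the chosen columns of g, h and l. *)
Lemma cusp_diffD r g h l : \det g = 1 -> \det h = 1 -> \det l = 1 ->
  cusp_diff r g h + cusp_diff r h l = cusp_diff r g l.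
Proof.
move=> g1 h1 l1; have [->|r0] := eqVneq r 0; first by rewrite !cusp_diff0 addr0.
move: (pivot_neq0 r0 g1) (pivot_neq0 r0 h1) (pivot_neq0 r0 l1).
rewrite /cusp_diff /pivot /col_det !mulmx2E.
move: (sel _) (sel _) (sel _) => i j k p0 q0 s0; field.
by rewrite p0 q0 s0.
Qed.

Lemma cusp_diffM r (a g h : 'M[K]_2) : \det a = 1 ->
  cusp_diff r (a *m g) (a *m h) = cusp_diff (r *m a) g h.
Proof. by move=> a1; rewrite /cusp_diff /pivot !mulmxA col_detM a1 mul1r. Qed.

End CuspDifference.

(** * The two choices of base point *)

Section Selectors.
Variable P : place 'F_2.
Implicit Types r : 'rV[P]_2.

(** The base point (1 : 0), replaced by (0 : 1) where its coordinate is infinite. *)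
Definition sel_fst r : 'I_2 := if r 0 0 != 0 then 0 else 1.

(** An entry of largest degree; under [place_eval P true] it has least order at t = 0. This
    maximality gives [pdeg_le_pivot]. *)
Definition sel_top r : 'I_2 :=
  if (r 0 0 != 0) && pdeg_le (pdeg (r 0 0)) (r 0 1) then 0 else 1.

Lemma row2_neq0 r : r != 0 -> r 0 0 != 0 \/ r 0 1 != 0.
Proof.
move=> r0; apply/orP; rewrite -negb_and; apply: contraNN r0 => /andP[/eqP a /eqP b].
by apply/eqP/matrixP => i j; rewrite ord1 mxE; case: (ord2P j) => ->.
Qed.

Lemma sel_fstP r : r != 0 -> r 0 (sel_fst r) != 0.
Proof. by rewrite /sel_fst => /row2_neq0[a|b]; [rewrite a | case: ifP]. Qed.

Lemma sel_topP r : r != 0 -> r 0 (sel_top r) != 0.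
Proof.
rewrite /sel_top => r0; case: ifP => [/andP[]//|/negbT].
rewrite negb_and negbK => /orP[/eqP a|]; last by rewrite negb_or => /andP[].
by case: (row2_neq0 r0) => //; rewrite a eqxx.
Qed.

Lemma sel_top_max r j : pdeg_le (pdeg (r 0 (sel_top r))) (r 0 j).
Proof.
have refl (z : P) : pdeg_le (pdeg z) z by rewrite /pdeg_le lexx orbT.
rewrite /sel_top; case: ifP => [/andP[a b]|/negbT]; first by case: (ord2P j) => ->.
rewrite negb_and negbK => h; case: (ord2P j) => -> //; move: h.
rewrite /pdeg_le negb_or -ltNge => /orP[->//|/andP[_ lt01]].
by rewrite (ltW lt01) orbT.
Qed.

End Selectors.

(** * The cusp cocycles *)

Section CuspCocycle.
Variable P : place 'F_2.
Local Notation L := (laurent int).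
Local Notation row_pair := ('rV[P]_2 * 'rV[P]_2)%type.
Implicit Types (g h : 'M[L]_2) (z : row_pair) (d e : nat).

Definition place_mx s m n (A : 'M[L]_(m, n)) : 'M[P]_(m, n) :=
  map_mx (place_eval P s) A.

Lemma place_mxM s m n p (A : 'M[L]_(m, n)) (B : 'M[L]_(n, p)) :
  place_mx s (A *m B) = place_mx s A *m place_mx s B.
Proof. exact: map_mxM. Qed.

Lemma place_mxE s m n (A : 'M[L]_(m, n)) i j : place_mx s A i j = place_eval P s (A i j).
Proof. exact: mxE. Qed.

Lemma det_place_mx s g : \det g = 1 -> \det (place_mx s g) = 1.
Proof. by move=> g1; rewrite det_map_mx g1 rmorph1. Qed.

Lemma col_det_place_mx s g h j k :
  col_det (place_mx s g) (place_mx s h) j k = place_eval P s (col_det g h j k).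
Proof. by rewrite /col_det !place_mxE rmorphB !rmorphM. Qed.

(** The pair of evaluations stands for the row mod 2, in place of a row over F_2[t,t^-1]. *)
Definition row_pair_of (rho : 'rV[L]_2) : row_pair :=
  (place_mx false rho, place_mx true rho).

Definition bottom_diff z g h : 'F_2 :=
  coef0p (cusp_diff (@sel_top P) z.2 (place_mx true g) (place_mx true h)).

Definition top_diff d z g h : 'F_2 :=
  coef0p (var P ^ (- d%:Z) *
    cusp_diff (@sel_fst P) z.1 (place_mx false g) (place_mx false h)).

(* The cup product of two translation cocycles attached to the cusp z. *)
Definition cusp_term d z g0 g1 g2 : 'F_2 :=
  bottom_diff z g0 g1 * top_diff d z g1 g2.

Lemma bottom_diffD z g0 g1 g2 : \det g0 = 1 -> \det g1 = 1 -> \det g2 = 1 ->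
  bottom_diff z g0 g1 + bottom_diff z g1 g2 = bottom_diff z g0 g2.
Proof.
move=> d0 d1 d2; rewrite /bottom_diff -raddfD /= (cusp_diffD (@sel_topP P)) //;
by apply: det_place_mx.
Qed.

Lemma top_diffD d z g0 g1 g2 : \det g0 = 1 -> \det g1 = 1 -> \det g2 = 1 ->
  top_diff d z g0 g1 + top_diff d z g1 g2 = top_diff d z g0 g2.
Proof.
move=> d0 d1 d2; rewrite /top_diff -raddfD /= -mulrDr (cusp_diffD (@sel_fstP P)) //;
by apply: det_place_mx.
Qed.

Definition row_pair_act z g : row_pair :=
  (z.1 *m place_mx false g, z.2 *m place_mx true g).

Lemma cusp_termM d z a g0 g1 g2 : \det a = 1 ->
  cusp_term d z (a *m g0) (a *m g1) (a *m g2) = cusp_term d (row_pair_act z a) g0 g1 g2.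
Proof.
move=> a1; rewrite /cusp_term /bottom_diff /top_diff !place_mxM.
by rewrite !cusp_diffM //; apply: det_place_mx.
Qed.

(** The Leibniz rule for a cup product: additivity splits the factors on (g0, g2) and (g1, g3), and
    everything cancels. *)
Lemma cusp_term_cocycle d z g0 g1 g2 g3 :
  \det g0 = 1 -> \det g1 = 1 -> \det g2 = 1 -> \det g3 = 1 ->
  cusp_term d z g1 g2 g3 - cusp_term d z g0 g2 g3 + cusp_term d z g0 g1 g3
    - cusp_term d z g0 g1 g2 = 0.
Proof.
move=> d0 d1 d2 d3; rewrite /cusp_term -(bottom_diffD z d0 d1 d2).
rewrite -(top_diffD d z d1 d2 d3); ring.
Qed.

Lemma place_mx_bounded g : exists N : nat, forall s j k, pdeg_le N%:Z (place_mx s g j k).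
Proof.
exists (\sum_(t : bool * 'I_2 * 'I_2) absz (pdeg (place_mx t.1.1 g t.1.2 t.2)))%N.
move=> s j k; rewrite (bigD1 (s, j, k)) //= /pdeg_le; apply/orP; right.
by rewrite PoszD; move: (pdeg _) (\sum_(_ | _) _)%N; lia.
Qed.

Lemma pdeg_le_mulmx m (A : 'M[P]_(m, 2)) n (B : 'M[P]_(2, n)) a b i j :
  (forall k, pdeg_le a (A i k)) -> (forall k, pdeg_le b (B k j)) ->
  pdeg_le (a + b) ((A *m B) i j).
Proof. by move=> hA hB; rewrite mulmx2E pdeg_leD ?pdeg_leM. Qed.

(* r is recovered from r g by the adjugate of g. *)
Lemma pdeg_le_pivot (r : 'rV[P]_2) (g : 'M[P]_2) N j : \det g = 1 ->
  (forall i k, pdeg_le N (g i k)) ->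
  pdeg_le (pdeg (pivot (@sel_top P) r g) + N) (r 0 j).
Proof.
move=> g1 gN; have rE : r = (r *m g) *m \adj g by rewrite -mulmxA mul_mx_adj g1 mulmx1.
rewrite [in X in pdeg_le _ X]rE; apply: pdeg_le_mulmx => k; first exact: sel_top_max.
rewrite mxE /cofactor det_mx11 !mxE.
by rewrite -signr_odd; case: (odd _); rewrite ?expr1 ?mulN1r ?pdeg_leN ?expr0 ?mul1r.
Qed.

Lemma pdeg_le_col_det (g h : 'M[P]_2) (N : int) j k :
  (forall i k, pdeg_le N (g i k)) -> (forall i k, pdeg_le N (h i k)) ->
  pdeg_le (N + N) (col_det g h j k).
Proof. by move=> gN hN; rewrite pdeg_leB ?pdeg_leM. Qed.

(** A nonzero value forces the degrees of the two pivots to add up to at most 2N, so one of them is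
    at most N, and [pdeg_le_pivot] applies to it. *)
Lemma bottom_diff_neq0 (N : int) z g h : \det g = 1 -> \det h = 1 ->
  (forall i k, pdeg_le N (place_mx true g i k)) ->
  (forall i k, pdeg_le N (place_mx true h i k)) ->
  bottom_diff z g h != 0 -> forall j, pdeg_le (N + N) (z.2 0 j).
Proof.
move=> g1 h1 gN hN; rewrite /bottom_diff.
have [->|r0] := eqVneq z.2 0; first by rewrite cusp_diff0 raddf0 eqxx.
move=> /coef0p_neq0[]; rewrite /cusp_diff.
have g1' := det_place_mx true g1; have h1' := det_place_mx true h1.
have := pivot_neq0 (@sel_topP P) r0 g1'; have := pivot_neq0 (@sel_topP P) r0 h1'.
have := pdeg_le_pivot z.2 _ g1' gN; have := pdeg_le_pivot z.2 _ h1' hN.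
have := pdeg_le_col_det (sel_top (z.2 *m place_mx true g))
  (sel_top (z.2 *m place_mx true h)) gN hN.
move: (pivot _ _ (place_mx true g)) (pivot _ _ (place_mx true h)) (col_det _ _ _ _).
move=> q q' D DN rq' rq q'0 q0.
rewrite mulf_eq0 negb_or => /andP[D0 qq'0].
rewrite pdegM // pdegV ?mulf_neq0 // pdegM // => h0 j.
move: DN; rewrite pdeg_leE // => DN.
have [qN|qN] := leP (pdeg q) N.
  by apply: pdeg_le_trans (rq j); lia.
apply: pdeg_le_trans (rq' j); move: DN qN h0.
move: (pdeg D) (pdeg q) (pdeg q') => a b c; lia.
Qed.


Lemma place_eval_bound_other s p (N : int) : place_eval P s p != 0 ->
  pdeg_le N (place_eval P (~~ s) p) -> - N <= pdeg (place_eval P s p).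
Proof.
move=> n0; have n0' := place_eval_neq0C (~~ s) n0; rewrite pdeg_leE // => h.
have := pdeg_place_eval_ge n0; move: h; move: (pdeg _) (pdeg _) => a b; lia.
Qed.

(** The bound M at t = 0 bounds both pivots from below at infinity. A nonzero value bounds the sum
    of their degrees by 2N, hence each by 3N + M, and Cramer's rule recovers the row. *)
Lemma top_diff_neq0 d (N M : int) (rho : 'rV[L]_2) g h : \det g = 1 -> \det h = 1 ->
  (forall s i k, pdeg_le N (place_mx s g i k)) ->
  (forall s i k, pdeg_le N (place_mx s h i k)) ->
  (forall j, pdeg_le M (place_mx true rho 0 j)) ->
  top_diff d (row_pair_of rho) g h != 0 ->
  forall j, pdeg_le (N *+ 6 + M) (place_mx false rho 0 j).
Proof.
move=> g1 h1 gN hN rM; rewrite /top_diff /=.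
have [->|r0] := eqVneq (place_mx false rho) 0.
  by rewrite cusp_diff0 mulr0 raddf0 eqxx.
move=> /coef0p_neq0[].
have q0 := pivot_neq0 (@sel_fstP P) r0 (det_place_mx false g1).
have q'0 := pivot_neq0 (@sel_fstP P) r0 (det_place_mx false h1).
have ge (f : 'M[L]_2) : (forall s i k, pdeg_le N (place_mx s f i k)) ->
    pivot (@sel_fst P) (place_mx false rho) (place_mx false f) != 0 ->
    - (M + N) <= pdeg (pivot (@sel_fst P) (place_mx false rho) (place_mx false f)).
  rewrite /pivot -place_mxM place_mxE => fN f0; apply: place_eval_bound_other => //=.
  rewrite -[place_eval _ true _]place_mxE place_mxM.
  by apply: pdeg_le_mulmx => k; [exact: rM | exact: fN].
have := ge g gN q0; have := ge h hN q'0.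
rewrite {ge}/cusp_diff => qge q'ge n0 degge j; move: n0 degge.
have := pdeg_le_col_det (sel_fst (place_mx false rho *m place_mx false g))
  (sel_fst (place_mx false rho *m place_mx false h)) (gN false) (hN false).
rewrite mulf_eq0 mulf_eq0 !negb_or => DN /and3P[_ D0 qq'0].
have Dge : - (N + N) <= pdeg (col_det (place_mx false g) (place_mx false h)
    (sel_fst (place_mx false rho *m place_mx false g))
    (sel_fst (place_mx false rho *m place_mx false h))).
  move: D0; rewrite col_det_place_mx => D0; apply: place_eval_bound_other => //.
  by rewrite -col_det_place_mx; apply: pdeg_le_col_det.
move: DN Dge; rewrite pdeg_leE // pdegM ?mulf_neq0 ?expfz_neq0 ?var_neq0 //.
rewrite pdegM // pdegV ?mulf_neq0 // pdegM // pdeg_varX => DN Dge dge.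
(* Pivots of degree at most 3N + M times matrix entries of degree at most N. Dividing by the
   determinant, of degree at least -2N, then gives 6N + M. *)
have rD : pdeg_le (N *+ 4 + M) (place_mx false rho 0 j * col_det (place_mx false g)
    (place_mx false h) (sel_fst (place_mx false rho *m place_mx false g))
    (sel_fst (place_mx false rho *m place_mx false h))).
  have qle : pdeg_le (N *+ 3 + M)
      (pivot (@sel_fst P) (place_mx false rho) (place_mx false g)).
    rewrite pdeg_leE //; move: qge q'ge DN dge.
    move: (pdeg _) (pdeg _) (pdeg _) => a b c; lia.
  have q'le : pdeg_le (N *+ 3 + M)
      (pivot (@sel_fst P) (place_mx false rho) (place_mx false h)).
    rewrite pdeg_leE //; move: qge q'ge DN dge.
    move: (pdeg _) (pdeg _) (pdeg _) => a b c; lia.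
  have -> : N *+ 4 + M = (N *+ 3 + M) + N by rewrite !mulrS mulr0n; lia.
  by case: (ord2P j) => ->; rewrite (mul_col_det0, mul_col_det1) pdeg_leB ?pdeg_leM.
move: rD; have [->|rj0] := eqVneq (place_mx false rho 0 j) 0; first by rewrite pdeg_le0.
rewrite !pdeg_leE ?mulf_neq0 // pdegM //; move: Dge.
move: (pdeg _) (pdeg _) => a b; lia.
Qed.

(** All rows are taken: this set is stable under SL_2, and rows that vanish mod 2 contribute 0 by
    [cusp_diff0]. *)
Definition cusps : set row_pair := range row_pair_of.

Lemma finite_cusp_term d g0 g1 g2 : \det g0 = 1 -> \det g1 = 1 -> \det g2 = 1 ->
  finite_set (cusps `&` [set z | cusp_term d z g0 g1 g2 != 0]).
Proof.
move=> d0 d1 d2.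
have [N0 b0] := place_mx_bounded g0; have [N1 b1] := place_mx_bounded g1.
have [N2 b2] := place_mx_bounded g2; pose N : nat := (N0 + N1 + N2)%N.
have c0 s i k : pdeg_le N%:Z (place_mx s g0 i k) by apply: pdeg_le_trans (b0 s i k); lia.
have c1 s i k : pdeg_le N%:Z (place_mx s g1 i k) by apply: pdeg_le_trans (b1 s i k); lia.
have c2 s i k : pdeg_le N%:Z (place_mx s g2 i k) by apply: pdeg_le_trans (b2 s i k); lia.
(* The bound 6N + M with M = 2N supplied by [bottom_diff_neq0]. *)
pose S := [set z : P * P | exists2 p, z = (place_eval P false p, place_eval P true p) &
    forall s, pdeg_le (N * 8)%N%:Z (place_eval P s p)].
pose f (w : (P * P) * (P * P)) : row_pair :=
  (\row_j if j == 0 then w.1.1 else w.2.1, \row_j if j == 0 then w.1.2 else w.2.2).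
apply: (@sub_finite_set _ _ (f @` (S `*` S))); last first.
  by apply: finite_image; apply: finite_setX; exact: finite_place_eval_bounded.
move=> _ [[rho _ <-]] /=; rewrite /cusp_term mulf_eq0 negb_or => /andP[h1 h2].
have t1 := bottom_diff_neq0 d0 d1 (c0 true) (c1 true) h1.
have t2 := top_diff_neq0 d1 d2 c1 c2 t1 h2.
have t s j : pdeg_le (N * 8)%N%:Z (place_eval P s (rho 0 j)).
  case: s; rewrite -place_mxE.
    by apply: pdeg_le_trans (t1 j); lia.
  by apply: pdeg_le_trans (t2 j); lia.
exists ((place_eval P false (rho 0 0), place_eval P true (rho 0 0)),
        (place_eval P false (rho 0 1), place_eval P true (rho 0 1))).
  by split => /=; [exists (rho 0 0) | exists (rho 0 1)].
by congr (_, _); apply/matrixP => i j; rewrite !mxE ord1; case: (ord2P j) => ->.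
Qed.

End CuspCocycle.

(** * Unipotent matrices and their coordinates *)

Section Unipotent.
Variable R : comNzRingType.

Definition unip (f : R) : 'M[R]_2 :=
  \matrix_(i, j) if i == j then 1 else if i == 0 then f else 0.

Lemma unipM f h : unip f *m unip h = unip (f + h).
Proof.
apply/matrixP => i j; rewrite mulmx2E !mxE.
by case: (ord2P i) => ->; case: (ord2P j) => -> /=; ring.
Qed.

Lemma det_unip f : \det (unip f) = 1.
Proof. by rewrite det2E !mxE /=; ring. Qed.

Lemma unip0 : unip 0 = 1%:M.
Proof. by apply/matrixP => i j; rewrite !mxE; case: (i == j); case: (i == 0). Qed.

Lemma mul_row_unip0 (r : 'rV[R]_2) f : (r *m unip f) 0 0 = r 0 0.
Proof. by rewrite mulmx2E !mxE /=; ring. Qed.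

Lemma mul_row_unip1 (r : 'rV[R]_2) f : (r *m unip f) 0 1 = r 0 0 * f + r 0 1.
Proof. by rewrite mulmx2E !mxE /=; ring. Qed.

End Unipotent.

Section UnipotentDifference.
Variable P : place 'F_2.
Implicit Types (r : 'rV[P]_2) (f h : P).

(** All upper unipotents share column 0, hence this base point. *)
Lemma cusp_diff_fst_unip r f h : r 0 0 != 0 ->
  cusp_diff (@sel_fst P) r (unip f) (unip h) = 0.
Proof.
move=> r0; rewrite /cusp_diff /sel_fst !mul_row_unip0 r0 /col_det !mxE /=.
by rewrite mulr0 mul0r subrr mul0r.
Qed.

Lemma cusp_diff_unip sel r f h : (forall r', r' 0 0 = 0 -> sel r' = 1) ->
  r 0 0 = 0 -> cusp_diff sel r (unip f) (unip h) = (f - h) / r 0 1 ^+ 2.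
Proof.
move=> selE r0; rewrite /cusp_diff /pivot !selE ?mul_row_unip0 // !mul_row_unip1.
by rewrite /col_det !mxE /= r0 !mul0r !add0r mulr1 mul1r.
Qed.

Lemma sel_fst1 r : r 0 0 = 0 -> sel_fst r = 1.
Proof. by rewrite /sel_fst => ->; rewrite eqxx. Qed.

Lemma sel_top1 r : r 0 0 = 0 -> sel_top r = 1.
Proof. by rewrite /sel_top => ->; rewrite eqxx. Qed.

End UnipotentDifference.

(** * The invariant cocycle and its values on unipotents *)

Section CuspSum.
Variable P : place 'F_2.
Local Notation L := (laurent int).
Implicit Types (g h : 'M[L]_2) (d e : nat).

(** A sum over finite support, which [finite_cusp_term] provides for matrices of determinant 1. *)
Definition cusp_sum d g0 g1 g2 : 'F_2 := \sum_(z \in @cusps P) cusp_term d z g0 g1 g2.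

Lemma row_pair_actE rho g : row_pair_act (row_pair_of P rho) g = row_pair_of P (rho *m g).
Proof. by rewrite /row_pair_of !place_mxM. Qed.

Lemma row_pair_act_bij a : \det a = 1 ->
  set_bij (@cusps P) (@cusps P) (fun z => row_pair_act z a).
Proof.
move=> a1; split.
- by move=> _ [rho _ <-] /=; rewrite row_pair_actE; exists (rho *m a).
- have pK s : place_mx P s a *m place_mx P s (\adj a) = 1%:M.
    by rewrite -place_mxM mul_mx_adj a1 /place_mx map_mx1.
  move=> z w _ _ /(congr1 (fun z => row_pair_act z (\adj a))).
  by rewrite /row_pair_act /= -!mulmxA !pK !mulmx1; case: z w => [? ?] [? ?].
- move=> _ [rho _ <-]; exists (row_pair_of P (rho *m \adj a)).
    by exists (rho *m \adj a).
  by rewrite row_pair_actE -mulmxA mul_adj_mx a1 mulmx1.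
Qed.

Lemma cusp_sumM d a g0 g1 g2 : \det a = 1 ->
  cusp_sum d (a *m g0) (a *m g1) (a *m g2) = cusp_sum d g0 g1 g2.
Proof.
move=> a1; rewrite /cusp_sum.
rewrite [RHS](@reindex_fsbig _ _ _ _ _ (fun z => row_pair_act z a)
  (@cusps P) (@cusps P)); last exact: row_pair_act_bij.
by apply: eq_fsbigr => z _; rewrite cusp_termM.
Qed.

Lemma cusp_sum_cocycle d g0 g1 g2 g3 :
  \det g0 = 1 -> \det g1 = 1 -> \det g2 = 1 -> \det g3 = 1 ->
  cusp_sum d g1 g2 g3 - cusp_sum d g0 g2 g3 + cusp_sum d g0 g1 g3
    - cusp_sum d g0 g1 g2 = 0.
Proof.
move=> d0 d1 d2 d3.
pose supp h0 h1 h2 := @cusps P `&` [set z | cusp_term d z h0 h1 h2 != 0].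
(* A common finite index set lets the identity be checked term by term. *)
pose A := supp g1 g2 g3 `|` supp g0 g2 g3 `|` supp g0 g1 g3 `|` supp g0 g1 g2.
have Afin : finite_set A.
  by rewrite !finite_setU; split; [split; [split|]|]; exact: finite_cusp_term.
have sumA h0 h1 h2 : supp h0 h1 h2 `<=` A ->
    cusp_sum d h0 h1 h2 = \sum_(z <- fset_set A) cusp_term d z h0 h1 h2.
  move=> hA; rewrite -fsbig_finite //; apply/esym/fsbig_widen.
    by move=> z; rewrite /A => -[[[]|]|] [].
  move=> z [zc zA] /=; apply: contrapT => h; apply/zA/hA; split=> //=; exact/eqP.
rewrite !sumA; do 1?[by move=> z hz; rewrite /A; do ?[by right|left]].
rewrite -sumrB -big_split -sumrB big1 // => z _ /=.
exact: cusp_term_cocycle.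
Qed.

Definition monomial e : L := << e%:Z >>.

Lemma place_mx_unip s (f : L) : place_mx P s (unip f) = unip (place_eval P s f).
Proof.
apply/matrixP => i j; rewrite place_mxE !mxE.
by do 2?case: eqP => _; rewrite ?rmorph1 ?rmorph0.
Qed.

Lemma cusp_term_unip d rho (f h : L) :
  cusp_term d (row_pair_of P rho) 1%:M (unip f) (unip h) =
  if place_eval P false (rho 0 0) == 0 then
    coef0p (- place_eval P true f / place_eval P true (rho 0 1) ^+ 2) *
    coef0p (var P ^ (- d%:Z) *
      (place_eval P false (f - h) / place_eval P false (rho 0 1) ^+ 2))
  else 0.
Proof.
rewrite /cusp_term /bottom_diff /top_diff -(unip0 L) !place_mx_unip /=.
case: eqP => [r0|/eqP r0]; last first.
  rewrite cusp_diff_fst_unip ?place_mxE //. by rewrite mulr0 coef0p0 mulr0.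
have r0' : place_eval P true (rho 0 0) = 0.
  by apply: contra_eq r0 => h0; exact: place_eval_neq0C h0.
rewrite !cusp_diff_unip ?place_mxE //; try exact: sel_fst1; try exact: sel_top1.
by rewrite rmorph0 sub0r rmorphB.
Qed.

Lemma coef0p_quot_neq0 (x y : P) : coef0p (x / y ^+ 2) != 0 ->
  y != 0 /\ pdeg y + pdeg y <= pdeg x.
Proof.
move=> /coef0p_neq0[]; rewrite mulf_eq0 invr_eq0 negb_or expf_eq0 /= => /andP[x0 y0].
rewrite pdegM ?invr_eq0 ?expf_eq0 // pdegV ?expf_eq0 // expr2 pdegM // => h.
by split=> //; move: h; move: (pdeg _) (pdeg _) => a b; lia.
Qed.

Lemma place_eval_monomial s e : place_eval P s (monomial e) = var P ^ (sgb s * e%:Z).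
Proof. exact: place_evalU. Qed.

(** For a row (0, y), nonzero factors would make twice the degree of y at most -e at t = 0 and at
    most -d at infinity, against [pdeg_place_eval_ge]. *)
Lemma cusp_sum_unip_swap d e : (0 < d)%N ->
  cusp_sum d 1%:M (unip (monomial e)) (unip (monomial e + 1)) = 0.
Proof.
move=> d0; apply: fsbig1 => _ [rho _ <-]; rewrite cusp_term_unip; case: ifP => // _.
apply/eqP; rewrite -[_ == _]negbK mulf_eq0 negb_or; apply/negP => /andP[].
move=> /coef0p_quot_neq0[y0]; rewrite mulrA => + /coef0p_quot_neq0[x0].
rewrite opprD addNKr rmorphN rmorph1 mulrN1 !pdegN place_eval_monomial !pdeg_varX.
have := pdeg_place_eval_ge x0; rewrite /sgb /=.
move: (pdeg _) (pdeg _) => a b; lia.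
Qed.

(** For a row (0, y), nonzero factors make twice the degree of y at most 0 at t = 0 and at most e -
    d at infinity, so y is 1 mod 2. The row (0, 1) contributes the var^0 coefficient of var^(e -
    d). *)
Lemma cusp_sum_unip d e : (e <= d)%N ->
  cusp_sum d 1%:M (unip 1) (unip (1 + monomial e)) = (e == d)%:R.
Proof.
move=> ed; pose z1 := row_pair_of P (\row_j if j == 0 then 0 else 1).
rewrite /cusp_sum -(@fsbig_widen _ _ _ _ [set z1] (@cusps P)) => [|_ -> |]; last 1 first.
- move=> _ [[rho _ <-] nz] /=; rewrite cusp_term_unip; case: eqP => // r0.
  apply/eqP; rewrite -[_ == _]negbK mulf_eq0 negb_or; apply/negP => /andP[].
  move=> /coef0p_quot_neq0[y0]; rewrite mulrA => + /coef0p_quot_neq0[x0].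
  rewrite opprD addNKr !rmorphN rmorph1 /= mulrN !pdegN place_eval_monomial.
  rewrite -expfzDr ?var_neq0 // pdeg_varX pdeg1 => y1 x1.
  have u : forall s, place_eval P s (rho 0 1) = 1.
    apply: place_eval_unit => //; rewrite pdeg_leE //.
      by move: x1; rewrite /sgb /=; move: (pdeg _) => a; lia.
    by move: y1; move: (pdeg _) => a; lia.
  have r0' : place_eval P true (rho 0 0) = 0.
    by apply: contra_eq r0 => h0; exact: place_eval_neq0C h0.
  apply: nz; congr (_, _); apply/matrixP => i j; rewrite !place_mxE !mxE ord1;
    by case: (ord2P j) => ->; rewrite /= ?rmorph0 ?rmorph1.
- rewrite fsbig_set1 cusp_term_unip !mxE /= rmorph0 eqxx !rmorph1 expr1n !divr1.
  rewrite opprD addNKr rmorphN /= mulrN place_eval_monomial -expfzDr ?var_neq0 //.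
  rewrite !raddfN /= mulrNN -(expr0z (var P)) !coef0p_varX eqxx mul1r.
  by congr (nat_of_bool _)%:R; rewrite /sgb /=; lia.
- by eexists.
Qed.

End CuspSum.

(** * Bar complex *)

Section BarTwo.
Variable G : groupType.

Lemma bar_dU n (g : n.+1.-tuple G) :
  bar_d << g >> = \sum_(i < n.+2) (-1) ^+ i *: << bar_face i g >> :> bar_chain G n.
Proof. exact: fglift1. Qed.

Lemma bar_d3 (a b c : G) : bar_d << [tuple a; b; c] >> =
  << [tuple b; c] >> - << [tuple (a * b)%g; c] >> + << [tuple a; (b * c)%g] >>
    - << [tuple a; b] >> :> bar_chain G 2.
Proof.
rewrite bar_dU !big_ord_recl big_ord0 /= expr0 expr1 sqrrN expr1n scale1r.
rewrite exprS sqrrN expr1n mulr1 !scaleN1r scale1r addr0 !addrA.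
by congr (<< _ >> - << _ >> + << _ >> - << _ >>); apply: eq_from_tnth => j;
  rewrite tnth_mktuple; case: (ord2P j) => ->; rewrite !(tnth_nth a).
Qed.

Lemma bar_d2 (a b : G) : bar_d << [tuple a; b] >> =
  << [tuple b] >> - << [tuple (a * b)%g] >> + << [tuple a] >> :> bar_chain G 1.
Proof.
rewrite bar_dU !big_ord_recl big_ord0 /= expr0 expr1 sqrrN expr1n scale1r.
rewrite !scaleN1r scale1r addr0 !addrA.
by congr (<< _ >> - << _ >> + << _ >>); apply: eq_from_tnth => j;
  rewrite tnth_mktuple ord1 !(tnth_nth a).
Qed.

End BarTwo.

(** * Detecting homology classes by 2-cocycles *)

Section Detection.
Variable G : groupType.
Variable V : zmodType.
Variable f : G -> G -> V.
Hypothesis f_cocycle : forall a b c : G,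
  f b c - f (a * b)%g c + f a (b * c)%g - f a b = 0.

Definition cochain_eval : bar_chain G 2 -> V :=
  zlift (fun t : 2.-tuple G => f (tnth t 0) (tnth t 1)).

HB.instance Definition _ := GRing.isZmodMorphism.Build (bar_chain G 2) V cochain_eval
  (zlift_zmod_morphism (fun t : 2.-tuple G => f (tnth t 0) (tnth t 1))).

Lemma cochain_evalU (a b : G) : cochain_eval << [tuple a; b] >> = f a b.
Proof. by rewrite /cochain_eval zliftU. Qed.

Lemma cochain_eval_boundary (c : bar_chain G 3) : cochain_eval (bar_d c) = 0.
Proof.
elim/freeg_zind: c => [|t|c c' IH IH']; first by rewrite !raddf0.
  have [a [b [c ->]]] : exists a b c, t = [tuple a; b; c].
    case: t => [[|a[|b[|c[|//]]]] // sz]; exists a, b, c; exact: val_inj.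
  rewrite bar_d3 !(raddfB, raddfD) /= !cochain_evalU; exact: f_cocycle.
by rewrite !raddfB /= IH IH' subrr.
Qed.

Lemma cochain_eval_homology (z w : bar_cycle G 2) :
  \pi_(homology G 2)%qT z = \pi_(homology G 2)%qT w ->
  cochain_eval z = cochain_eval w.
Proof.
move=> /eqP; rewrite -Quotient.idealrBE => /asboolP[c /= zw].
by apply/eqP; rewrite -subr_eq0 -raddfB zw; apply/eqP; exact: cochain_eval_boundary.
Qed.

End Detection.

(* Reduction mod 2 of the evaluations of N > m cocycles on N classes cannot be
   unitriangular if m classes generate. *)
Lemma not_finitely_generated_homology2 (G : groupType) (f : nat -> G -> G -> 'F_2)
    (z : nat -> bar_cycle G 2) :
  (forall d (a b c : G),
    f d b c - f d (a * b)%g c + f d a (b * c)%g - f d a b = 0) ->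
  (forall d e, (e <= d)%N -> cochain_eval (f d) (z e) = (e == d)%:R) ->
  ~ finitely_generated (homology G 2).
Proof.
move=> fc fz [m [s sgen]].
pose t (j : 'I_m) : bar_cycle G 2 := repr (s`_j).
have /boolp.choice[a za] : forall e : 'I_m.+1, exists b : int ^ m,
    \pi_(homology G 2)%qT (z e) = \sum_(j < m) s`_j *~ b j.
  by move=> e; exact: sgen.
pose ev d := @cochain_eval G _ (f d).
pose A : 'M['F_2]_m.+1 := \matrix_(e, d) ev d (z e).
pose B : 'M['F_2]_(m.+1, m) := \matrix_(e, j) (a e j)%:~R.
pose C : 'M['F_2]_(m, m.+1) := \matrix_(j, d) ev d (t j).
(* Cocycles are constant on homology classes, so writing the classes in the m generators factors the
   value matrix through rank m. *)
have AE : A = B *m C.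
  apply/matrixP => e d; rewrite !mxE.
  rewrite /ev (cochain_eval_homology (fc d) (w := \sum_(j < m) t j *~ a e j)).
    rewrite -[bar_cycle_val _]/(val _) !raddf_sum /=; apply: eq_bigr => j _.
    by rewrite !mxE -[bar_cycle_val _]/(val _) !raddfMz /= mulrzl.
  rewrite za raddf_sum; apply: eq_bigr => j _.
  by rewrite raddfMz /= reprK.
have A1 : \det A = 1.
  rewrite det_trig; first by rewrite big1 // => e _; rewrite mxE /ev fz // eqxx.
  by apply/is_trig_mxP => e d ed; rewrite mxE /ev fz ?(ltnW ed) // ltn_eqF.
have : \rank A = m.+1 by apply: mxrank_unit; rewrite unitmxE A1 unitr1.
have := mxrankM_maxl B C; rewrite -AE => + rA.
by rewrite rA => /leq_trans/(_ (rank_leq_col B)); rewrite ltnn.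
Qed.

Section Torus.
Variable G : groupType.
Variables a b : G.
Hypothesis ab : (a * b = b * a)%g.

(** The image of the fundamental class of the torus under the map from Z^2 given by a commuting
    pair. *)
Definition torus_chain : bar_chain G 2 := << [tuple a; b] >> - << [tuple b; a] >>.

Lemma torus_chain_cycle : torus_chain \in @is_bar_cycle G 2.
Proof.
rewrite unfold_in /= /torus_chain raddfB /= !bar_d2 ab.
by rewrite subr_eq0 addrAC [eqbRHS]addrAC [<< [tuple b] >> + _]addrC.
Qed.

Definition torus_cycle : bar_cycle G 2 := MkBarCycle torus_chain_cycle.

End Torus.

Definition unipSL (f : laurent int) : 'SL_2[laurent int] :=
  MkSL (introT eqP (det_unip f)).

Lemma unipSLM f h : (unipSL f * unipSL h)%g = unipSL (f + h).
Proof. by apply: val_inj; exact: unipM. Qed.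

Theorem theorem3p1 :
  ~ finitely_generated (homology 'SL_2[laurent int] 2).
Proof.
have P : place 'F_2 := place_at_infinity _.
(* The inhomogeneous form of the cocycle. Indices start at 1 because [cusp_sum_unip_swap] requires d
   > 0. *)
pose c d (g h : 'SL_2[laurent int]) := cusp_sum P d.+1 1%:M g (val g *m val h).
have comm e : (unipSL 1%R * unipSL (monomial e.+1) =
    unipSL (monomial e.+1) * unipSL 1%R)%g.
  by rewrite !unipSLM addrC.
apply: (@not_finitely_generated_homology2 _ c (fun e => torus_cycle (comm e))).
  move=> d g1 g2 g3; rewrite /c /=.
  (* Translation by g1 reduces the claim to the homogeneous identity at 1, g1, g1 g2, g1 g2 g3. *)
  have := cusp_sumM P d.+1 1%:M (val g2) (val g2 *m val g3) (SL_det g1).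
  rewrite mulmx1 mulmxA => <-.
  apply: cusp_sum_cocycle; rewrite ?det1 ?det_mulmx ?SL_det ?mulr1 //.
move=> d e ed; rewrite /torus_cycle /= raddfB /= !cochain_evalU /c /= !unipM.
by rewrite cusp_sum_unip // cusp_sum_unip_swap // subr0 eqSS.
Qed.
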